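(* Let $e_0,\tilde e_1,e_\infty\in\mathbb C^*$, $a_0=e_0+e_0^{-1}$, $a_\infty=e_\infty+e_\infty^{-1}$. The polynomial $\tilde F(\tilde X,\tilde\theta)$ can be decomposed as \begin{align*} \tilde F&=(\tilde X_1-\tilde e_1-\tfrac1{\tilde e_1})\tilde F_{\tilde X_1}+\tilde e_1(\tilde X_\infty+\tfrac{\tilde X_0}{\tilde e_1}-a_\infty)(\tilde X_0+\tfrac{\tilde X_\infty}{\tilde e_1}-a_0)\\ &=(\tilde X_1-e_0e_\infty-\tfrac1{e_0e_\infty})\tilde F_{\tilde X_1}+(e_0\tilde X_\infty+\tfrac{\tilde X_0}{e_\infty}-\tilde e_1-\tfrac{e_0}{e_\infty})(\tfrac{\tilde X_\infty}{e_0}+e_\infty\tilde X_0-\tilde e_1-\tfrac{e_\infty}{e_0})\\ &=(\tilde X_1-\tfrac{e_0}{e_\infty}-\tfrac{e_\infty}{e_0})\tilde F_{\tilde X_1}+(e_0\tilde X_\infty+e_\infty\tilde X_0-\tilde e_1-e_0e_\infty)(\tfrac{\tilde X_\infty}{e_0}+\tfrac{\tilde X_0}{e_\infty}-\tilde e_1-\tfrac1{e_0e_\infty})\\ &=(\tilde X_0-e_0)(\tilde F_{\tilde X_0}-\tilde X_0+e_0)+(\tilde X_\infty-\tfrac{\tilde e_1}{e_0})(e_0\tilde X_1+\tilde X_\infty-\tilde e_1e_0-a_\infty)\\ &=(\tilde X_0-e_0)(\tfrac{\tilde e_1}{e_0}\tilde X_1+\tilde X_0-\tfrac1{e_0}-\tilde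 e_1a_\infty)+(\tilde X_\infty-\tfrac{\tilde e_1}{e_0})(\tilde F_{\tilde X_\infty}-\tilde X_\infty+\tfrac{\tilde e_1}{e_0})\\ &=(\tilde X_0-\tfrac1{e_0})(\tilde F_{\tilde X_0}-\tilde X_0+\tfrac1{e_0})+(\tilde X_\infty-\tilde e_1e_0)(\tfrac{\tilde X_1}{e_0}+\tilde X_\infty-\tfrac{\tilde e_1}{e_0}-a_\infty)\\ &=(\tilde X_0-\tfrac1{e_0})(\tilde e_1e_0\tilde X_1+\tilde X_0-e_0-\tilde e_1a_\infty)+(\tilde X_\infty-\tilde e_1e_0)(\tilde F_{\tilde X_\infty}-\tilde X_\infty+\tilde e_1e_0)\\ &=(\tilde X_\infty-e_\infty)(\tilde F_{\tilde X_\infty}-\tilde X_\infty+e_\infty)+(\tilde X_0-\tfrac{\tilde e_1}{e_\infty})(e_\infty\tilde X_1+\tilde X_0-\tilde e_1e_\infty-a_0)\\ &=(\tilde X_\infty-e_\infty)(\tfrac{\tilde e_1}{e_\infty}\tilde X_1+\tilde X_\infty-\tfrac1{e_\infty}-\tilde e_1a_0)+(\tilde X_0-\tfrac{\tilde e_1}{e_\infty})(\tilde F_{\tilde X_0}-\tilde X_0+\tfrac{\tilde e_1}{e_\infty})\\ &=(\tilde X_\infty-\tfrac1{e_\infty})(\tilde F_{\tilde X_\infty}-\tilde X_\infty+\tfrac1{e_\infty})+(\tilde X_0-\tilde e_1e_\infty)(\tfrac{\tilde X_1}{e_\infty}+\tilde X_0-\tfrac{\tilde e_1}{e_\infty}-a_0)\\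 &=(\tilde X_\infty-\tfrac1{e_\infty})(\tilde e_1e_\infty\tilde X_1+\tilde X_\infty-e_\infty-\tilde e_1a_0)+(\tilde X_0-\tilde e_1e_\infty)(\tilde F_{\tilde X_0}-\tilde X_0+\tilde e_1e_\infty), \end{align*} thus defining 18 lines on $\mathcal S_V(\tilde\theta)$: in each decomposition (a sum of two products) a line is obtained by equating to zero one affine-linear factor of the first product and one affine-linear factor of the second product (some of the lines appear twice among these eleven decompositions of $\tilde F$).
   Context: For $\tilde X=(\tilde X_0,\tilde X_1,\tilde X_\infty)\in\mathbb C^3$, $\tilde F(\tilde X,\tilde\theta)=\tilde X_0\tilde X_1\tilde X_\infty+\tilde X_0^2+\tilde X_\infty^2-\tilde\theta_0\tilde X_0-\tilde\theta_1\tilde X_1-\tilde\theta_\infty\tilde X_\infty+\tilde\theta_t$, with $\tilde\theta_0=a_0+\tilde e_1a_\infty$, $\tilde\theta_1=\tilde e_1$, $\tilde\theta_\infty=a_\infty+\tilde e_1a_0$, $\tilde\theta_t=1+\tilde e_1a_0a_\infty+\tilde e_1^2$. The wild character variety of $P_V$ is $\mathcal S_V(\tilde\theta)=\{\tilde F=0\}\subset\mathbb C^3$. Partial derivatives: $\tilde F_{\tilde X_0}=\tilde X_1\tilde X_\infty+2\tilde X_0-\tilde\theta_0$, $\tilde F_{\tilde X_1}=\tilde X_\infty\tilde X_0-\tilde\theta_1$, $\tilde F_{\tilde X_\infty}=\tilde X_1\tilde X_0+2\tilde X_\infty-\tilde\theta_\infty$. (In the paper $e_0=e^{\pi i\vartheta_0}$,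 $\tilde e_1=e^{\pi i\tilde\vartheta_1}$, $e_\infty=e^{\pi i\vartheta_\infty}$ with $\vartheta_0,\tilde\vartheta_1,\vartheta_\infty\in\mathbb C$ arbitrary.) *)

(* Defs.v *)
From mathcomp Require Import all_boot all_order all_algebra.
From mathcomp Require Import classical_sets reals complex mpoly.

Set Implicit Arguments.
Unset Strict Implicit.
Unset Printing Implicit Defensive.

Import GRing.Theory.
Local Open Scope ring_scope.

(* The variables X_0, X_1, X_oo of C^3 are numbered 0, 1, 2. *)
Definition ix0 : 'I_3 := @Ordinal 3 0 isT.
Definition ix1 : 'I_3 := @Ordinal 3 1 isT.
Definition ixoo : 'I_3 := @Ordinal 3 2 isT.

Definition Ftilde (R : realType) (th0 th1 thoo tht : R[i]) : {mpoly R[i][3]} :=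
  let X0 := 'X_ix0 in let X1 := 'X_ix1 in let Xoo := 'X_ixoo in
  X0 * X1 * Xoo + X0 ^+ 2 + Xoo ^+ 2
  - th0 *: X0 - th1 *: X1 - thoo *: Xoo + tht%:MP.

(* In what follows e1 stands for e_1 tilde. *)
Definition FV (R : realType) (e0 e1 eoo : R[i]) : {mpoly R[i][3]} :=
  let a0 := e0 + e0^-1 in let aoo := eoo + eoo^-1 in
  Ftilde (a0 + e1 * aoo) e1 (aoo + e1 * a0) (1 + e1 * a0 * aoo + e1 ^+ 2).

Definition zero_locus (R : realType) (p : {mpoly R[i][3]}) : set 'rV[R[i]]_3 :=
  [set x | p.@[x 0] = 0]%classic.

Definition SV (R : realType) (e0 e1 eoo : R[i]) : set 'rV[R[i]]_3 :=
  zero_locus (FV e0 e1 eoo).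

(* ((A, B), (C, D)) encodes the sum of two products A * B + C * D. *)
Definition two_products (R : realType) : Type :=
  (({mpoly R[i][3]} * {mpoly R[i][3]}) * ({mpoly R[i][3]} * {mpoly R[i][3]}))%type.

Definition two_products_val (R : realType) (D : two_products R) : {mpoly R[i][3]} :=
  D.1.1 * D.1.2 + D.2.1 * D.2.2.

(* In the first decomposition the scalar e1 is absorbed in the first factor of
   the second product. *)
Definition decompositions (R : realType) (e0 e1 eoo : R[i]) :
    11.-tuple (two_products R) :=
  let X0 : {mpoly R[i][3]} := 'X_ix0 in
  let X1 : {mpoly R[i][3]} := 'X_ix1 in
  let Xoo : {mpoly R[i][3]} := 'X_ixoo in
  let a0 := e0 + e0^-1 in
  let aoo := eoo + eoo^-1 in
  let F := FV e0 e1 eoo in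
  let F0 := F^`M(ix0) in
  let F1 := F^`M(ix1) in
  let Foo := F^`M(ixoo) in
  [tuple
    ((X1 - e1%:MP - (e1^-1)%:MP, F1),
     (e1 *: (Xoo + e1^-1 *: X0 - aoo%:MP), X0 + e1^-1 *: Xoo - a0%:MP));
    ((X1 - (e0 * eoo)%:MP - ((e0 * eoo)^-1)%:MP, F1),
     (e0 *: Xoo + eoo^-1 *: X0 - e1%:MP - (e0 / eoo)%:MP,
      e0^-1 *: Xoo + eoo *: X0 - e1%:MP - (eoo / e0)%:MP));
    ((X1 - (e0 / eoo)%:MP - (eoo / e0)%:MP, F1),
     (e0 *: Xoo + eoo *: X0 - e1%:MP - (e0 * eoo)%:MP,
      e0^-1 *: Xoo + eoo^-1 *: X0 - e1%:MP - ((e0 * eoo)^-1)%:MP));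
    ((X0 - e0%:MP, F0 - X0 + e0%:MP),
     (Xoo - (e1 / e0)%:MP, e0 *: X1 + Xoo - (e1 * e0)%:MP - aoo%:MP));
    ((X0 - e0%:MP, (e1 / e0) *: X1 + X0 - (e0^-1)%:MP - (e1 * aoo)%:MP),
     (Xoo - (e1 / e0)%:MP, Foo - Xoo + (e1 / e0)%:MP));
    ((X0 - (e0^-1)%:MP, F0 - X0 + (e0^-1)%:MP),
     (Xoo - (e1 * e0)%:MP, e0^-1 *: X1 + Xoo - (e1 / e0)%:MP - aoo%:MP));
    ((X0 - (e0^-1)%:MP, (e1 * e0) *: X1 + X0 - e0%:MP - (e1 * aoo)%:MP),
     (Xoo - (e1 * e0)%:MP, Foo - Xoo + (e1 * e0)%:MP));
    ((Xoo - eoo%:MP, Foo - Xoo + eoo%:MP),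
     (X0 - (e1 / eoo)%:MP, eoo *: X1 + X0 - (e1 * eoo)%:MP - a0%:MP));
    ((Xoo - eoo%:MP, (e1 / eoo) *: X1 + Xoo - (eoo^-1)%:MP - (e1 * a0)%:MP),
     (X0 - (e1 / eoo)%:MP, F0 - X0 + (e1 / eoo)%:MP));
    ((Xoo - (eoo^-1)%:MP, Foo - Xoo + (eoo^-1)%:MP),
     (X0 - (e1 * eoo)%:MP, eoo^-1 *: X1 + X0 - (e1 / eoo)%:MP - a0%:MP));
    ((Xoo - (eoo^-1)%:MP, (e1 * eoo) *: X1 + Xoo - eoo%:MP - (e1 * a0)%:MP),
     (X0 - (e1 * eoo)%:MP, F0 - X0 + (e1 * eoo)%:MP))].

(* msize is 1 + total degree, and is 0 for the zero polynomial. *)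
Definition affine_linear (R : realType) (p : {mpoly R[i][3]}) : bool :=
  msize p == 2%N.

Definition factor (R : realType) (q : {mpoly R[i][3]} * {mpoly R[i][3]}) (b : bool) :
  {mpoly R[i][3]} := if b then q.2 else q.1.

(* A decomposition, together with one factor of each of its two products; this
   type does not depend on the parameters, so that lines can be followed when
   the parameters vary. *)
Definition factor_choice : Type := ('I_11 * (bool * bool))%type.

Definition fst_factor (R : realType) (e0 e1 eoo : R[i]) (c : factor_choice) :=
  factor (tnth (decompositions e0 e1 eoo) c.1).1 c.2.1.

Definition snd_factor (R : realType) (e0 e1 eoo : R[i]) (c : factor_choice) :=
  factor (tnth (decompositions e0 e1 eoo) c.1).2 c.2.2.

Definition admissible (R : realType) (e0 e1 eoo : R[i]) (c : factor_choice) : bool :=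
  affine_linear (fst_factor e0 e1 eoo c) && affine_linear (snd_factor e0 e1 eoo c).

Definition line (R : realType) (e0 e1 eoo : R[i]) (c : factor_choice) :
    set 'rV[R[i]]_3 :=
  (zero_locus (fst_factor e0 e1 eoo c) `&` zero_locus (snd_factor e0 e1 eoo c))%classic.

Definition is_affine_line (R : realType) (L : set 'rV[R[i]]_3) : Prop :=
  exists p d : 'rV[R[i]]_3,
    d != 0 /\ L = [set x | exists t : R[i], x = p + t *: d]%classic.

(* For special parameters some of the 18 lines collide: for instance the lines
   (X_0, X_oo) = (e0, e1 / e0) and (X_0, X_oo) = (1 / e0, e1 * e0) coincide when
   e0 ^ 2 = 1.  The following condition excludes all such collisions. *)
Definition generic_parameters (R : realType) (e0 e1 eoo : R[i]) : Prop :=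
  [/\ e0 ^+ 2 != 1, eoo ^+ 2 != 1 &
      e1 \notin [:: e0 * eoo; (e0 * eoo)^-1; e0 / eoo; eoo / e0]].

(* Main.v *)
(** In each decomposition the difference of the two sides is a combination of
    the polynomials [1 - e / e], with [e] one of the parameters, hence vanishes.
    The factors built on a partial derivative of [FV] are the only ones that are
    not affine-linear, which leaves 22 choices of factors.  Each of them cuts out
    a line of one of four shapes, and each shape determines its two parameters;
    distinctness of the 18 lines thus becomes distinctness of 18 explicit
    triples.  A coincidence of two triples is a monomial relation between [e0],
    [e1] and [eoo] that genericity forbids, except for three pairs of lines in a
    plane of constant [X1], where the second equation is needed too. *)

Require Import Defs.
From mathcomp Require Import all_boot all_order all_algebra.
From mathcomp Require Import boolp classical_sets reals complex mpoly ring.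
Import GRing.Theory.
Local Open Scope ring_scope.

(** * Degrees of polynomials and their derivatives *)

Section Mpoly.
Context {n : nat} {S : nzRingType}.
Implicit Types p q : {mpoly S[n]}.

Lemma mderivXU (i j : 'I_n) : ('X_j : {mpoly S[n]})^`M(i) = (i == j)%:R%:MP.
Proof.
rewrite mderivX mnm1E eq_sym; case: eqP => [->|_]; last by rewrite scale0r mpolyC0.
by rewrite -{1}[U_(j)%MM]add0m addmK mpolyX0 scale1r mpolyC1.
Qed.

(** A monomial [m] of the derivative comes from [m + U_(i)] in [p], because a zero coefficient stays
    zero; its degree is one less. *)
Lemma msize_mderiv p i : (msize p^`M(i) <= (msize p).-1)%N.
Proof.
rewrite {1}msizeE big_tnth; apply/bigmax_leqP => /= k _.
have := mem_tnth k (in_tuple (msupp p^`M(i))).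
set m := tnth _ _ => mp.
have : (m + U_(i))%MM \in msupp p.
  move: mp; rewrite !mcoeff_msupp mcoeff_deriv; apply: contraNN => /eqP ->.
  by rewrite mul0rn.
by move/msize_mdeg_lt; rewrite mdegD mdeg1 addn1; case: (msize p).
Qed.

(** This bound and the next four leave [k] free, so that they chain backwards along the structure of
    a polynomial. *)
Lemma msizeD_leq k p q : (msize p <= k -> msize q <= k -> msize (p + q) <= k)%N.
Proof. by move=> pk qk; rewrite (leq_trans (msizeD_le _ _)) // geq_max pk. Qed.

Lemma msizeN_leq k p : (msize p <= k -> msize (- p) <= k)%N.
Proof. by rewrite msizeN. Qed.

Lemma msizeZ_leq k a p : (msize p <= k -> msize (a *: p) <= k)%N.
Proof. exact/leq_trans/mmeasureZ_le. Qed.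

Lemma msizeXU_leq (i : 'I_n) k : (2 <= k -> msize ('X_i : {mpoly S[n]}) <= k)%N.
Proof. by rewrite msizeX mdeg1. Qed.

Lemma msizeC_leq a k : (1 <= k -> msize (a%:MP : {mpoly S[n]}) <= k)%N.
Proof. by rewrite msizeC; apply: leq_trans; case: eqP. Qed.

End Mpoly.

Section Lines.
Context {R : realType}.
Implicit Types e eoo : R[i].
Local Notation X0 := ('X_ix0 : {mpoly R[i][3]}).
Local Notation X1 := ('X_ix1 : {mpoly R[i][3]}).
Local Notation Xoo := ('X_ixoo : {mpoly R[i][3]}).

(** * Partial derivatives and the eleven identities *)

Definition mderiv_simp :=
  (mderivD, mderivB, mderivN, mderivM, mderivZ, mderivC,
   @mderivXU 3 R[i]).

Lemma FV_mderiv e0 e1 eoo :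
  let a0 := e0 + e0^-1 in let aoo := eoo + eoo^-1 in
  [/\ (FV e0 e1 eoo)^`M(ix0) = X1 * Xoo + 2%:R * X0 - (a0 + e1 * aoo)%:MP,
      (FV e0 e1 eoo)^`M(ix1) = Xoo * X0 - e1%:MP &
      (FV e0 e1 eoo)^`M(ixoo) = X0 * X1 + 2%:R * Xoo - (aoo + e1 * a0)%:MP].
Proof.
by rewrite /FV /Ftilde !expr2 !mderiv_simp /= -!mul_mpolyC !mpolyC0 !mpolyC1; split; ring.
Qed.

Lemma FV_decomposition e0 e1 eoo (i : 'I_11) :
  e0 != 0 -> e1 != 0 -> eoo != 0 ->
  FV e0 e1 eoo = two_products_val (tnth (decompositions e0 e1 eoo) i).
Proof.
move=> e0n0 e1n0 eoon0.
(* Polynomials do not form a field, so the identities are left to [ring], to which a parameter and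
   its inverse are unrelated; these relations make up for it. *)
have mpolyCV (e : R[i]) : e != 0 -> 1 - e%:MP * (e^-1)%:MP = 0 :> {mpoly R[i][3]}.
  by move=> en0; rewrite -mpolyCM divff // mpolyC1 subrr.
have [[V0 V1] Voo] := (mpolyCV _ e0n0, mpolyCV _ e1n0, mpolyCV _ eoon0).
have [d0 d1 doo] := FV_mderiv e0 e1 eoo.
have split_zero (d p q : {mpoly R[i][3]}) : d = 0 -> p = q + d -> p = q.
  by move=> -> ->; rewrite addr0.
(* Cofactors of the vanishing terms [1 - e / e]: [K0] for the first
   decomposition, [K12] and [K12'] for the next two, [K] for the others. *)
pose K0 := (e1^-1)%:MP * Xoo * X0 + Xoo ^+ 2 + X0 ^+ 2
  - (e0 + e0^-1)%:MP * X0 - (eoo + eoo^-1)%:MP * Xoo + 1.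
pose K12 := Xoo ^+ 2 - (eoo + eoo^-1)%:MP * Xoo + 1.
pose K12' := X0 ^+ 2 - (e0 + e0^-1)%:MP * X0 + e0%:MP * (e0^-1)%:MP.
pose K := 1 - e1%:MP * X1 + e1%:MP ^+ 2.
rewrite (tnth_nth ((0, 0), (0, 0))).
case: i => [[|[|[|[|[|[|[|[|[|[|[|//]]]]]]]]]]] ?] /=.
all: rewrite /two_products_val /= ?{}d0 ?{}d1 ?{}doo /FV /Ftilde ?invfM.
all: rewrite -!mul_mpolyC.
1: apply: (split_zero ((1 - e1%:MP * (e1^-1)%:MP) * K0)); last by rewrite /K0; ring.
1: by rewrite V1 mul0r.
1,2: apply: (split_zero ((1 - e0%:MP * (e0^-1)%:MP) * K12 +
    (1 - eoo%:MP * (eoo^-1)%:MP) * K12')); last by rewrite /K12 /K12'; ring.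
1,2: by rewrite V0 Voo !mul0r addr0.
1-4: apply: (split_zero ((1 - e0%:MP * (e0^-1)%:MP) * K)); last by rewrite /K; ring.
1-4: by rewrite V0 mul0r.
all: apply: (split_zero ((1 - eoo%:MP * (eoo^-1)%:MP) * K)); last by rewrite /K; ring.
all: by rewrite Voo mul0r.
Qed.

(** * Criteria for affine-linear factors *)

(** Were [p] constant, its derivative would vanish; at the origin that derivative is just the
    coefficient of the variable. *)
Lemma affine_linearP {p : {mpoly R[i][3]}} i :
  (msize p <= 2)%N -> p^`M(i).@[fun=> 0] != 0 -> affine_linear p.
Proof.
move=> p2 pi0; rewrite /affine_linear eqn_leq p2 /= ltnNge; apply/negP => p1.
have : msize p^`M(i) == 0%N.
  by rewrite -leqn0 (leq_trans (msize_mderiv _ _)) //; case: (msize p) p1 => [|[]].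
by rewrite msize_poly_eq0 => /eqP p0; rewrite p0 meval0 eqxx in pi0.
Qed.

(** Differentiating twice kills every polynomial of degree 1. *)
Lemma affine_linearN {p : {mpoly R[i][3]}} i j :
  p^`M(i)^`M(j).@[fun=> 0] != 0 -> affine_linear p = false.
Proof.
move=> pij; apply/negP => /eqP p2.
have : msize p^`M(i)^`M(j) == 0%N.
  rewrite -leqn0 (leq_trans (msize_mderiv _ _)) //.
  by have := msize_mderiv p i; rewrite p2; case: (msize _) => [|[]].
by rewrite msize_poly_eq0 => /eqP p0; rewrite p0 meval0 eqxx in pij.
Qed.

Definition meval_simp := (mevalD, mevalB, mevalN, mevalM, mevalZ, mevalC, mevalXU).
Definition arith_simp :=
  (@mulr0 R[i], @mul0r R[i], @mulr1 R[i], @mul1r R[i], @addr0 R[i], @add0r R[i],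
   @subr0 R[i], @sub0r R[i], @oppr0 R[i]).

(** Each of the three keeps a mixed monomial, [Xoo * X0], [X1 * Xoo] and [X0 * X1] respectively,
    which a mixed second derivative detects. *)
Lemma FV_mderiv_not_affine e0 e1 eoo a :
  [/\ affine_linear (FV e0 e1 eoo)^`M(ix1) = false,
      affine_linear ((FV e0 e1 eoo)^`M(ix0) - X0 + a%:MP) = false &
      affine_linear ((FV e0 e1 eoo)^`M(ixoo) - Xoo + a%:MP) = false].
Proof.
have [d0 d1 doo] := FV_mderiv e0 e1 eoo; rewrite d0 d1 doo; split.
- by apply: (affine_linearN ix0 ixoo);
    rewrite !(mderiv_simp, meval_simp) /= ?arith_simp oner_eq0.
- by apply: (affine_linearN ix1 ixoo);
    rewrite -mpolyC_nat !(mderiv_simp, meval_simp) /= ?arith_simp oner_eq0.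
- by apply: (affine_linearN ix0 ix1);
    rewrite -mpolyC_nat !(mderiv_simp, meval_simp) /= ?arith_simp oner_eq0.
Qed.

(** * Lines of four shapes and their parameters *)

Definition row3 (a b c : R[i]) : 'rV[R[i]]_3 := \row_j nth 0 [:: a; b; c] j.

Lemma row3P (x y : 'rV[R[i]]_3) :
  x = y <-> [/\ x 0 ix0 = y 0 ix0, x 0 ix1 = y 0 ix1 & x 0 ixoo = y 0 ixoo].
Proof.
split=> [-> //|[h0 h1 hoo]]; apply/rowP => -[[|[|[|//]]] lt_i].
- by rewrite (_ : Ordinal _ = ix0) //; apply: val_inj.
- by rewrite (_ : Ordinal _ = ix1) //; apply: val_inj.
- by rewrite (_ : Ordinal _ = ixoo) //; apply: val_inj.
Qed.

(* [(k, u, c)] stands for the line [X1 = u + 1 / u, Xoo + u X0 = c] if [k = 0],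
   for a line parallel to the [X1]-axis if [k = 1], and for a line in a plane of
   constant [X0], resp. [Xoo], if [k = 2], resp. [k >= 3], where the
   constant [u] happens to be the slope as well. *)
Definition line_eqns : Type := (nat * R[i] * R[i])%type.

Definition line_of (D : line_eqns) : set 'rV[R[i]]_3 :=
  let: (k, u, c) := D in
  [set x | match k with
           | 0 => x 0 ix1 = u + u^-1 /\ x 0 ixoo + u * x 0 ix0 = c
           | 1 => x 0 ix0 = u /\ x 0 ixoo = c
           | 2 => x 0 ix0 = u /\ u * x 0 ix1 + x 0 ixoo = c
           | _ => x 0 ixoo = u /\ u * x 0 ix1 + x 0 ix0 = c
           end]%classic.

(** The point with [X0 = 0] for the first shape and with [X1 = 0] for the others; that same
    coordinate then parametrizes the line. *)
Definition base_point (D : line_eqns) : 'rV[R[i]]_3 :=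
  let: (k, u, c) := D in
  match k with
  | 0 => row3 0 (u + u^-1) c
  | 1 => row3 u 0 c
  | 2 => row3 u 0 c
  | _ => row3 c 0 u
  end.

Definition direction (D : line_eqns) : 'rV[R[i]]_3 :=
  let: (k, u, c) := D in
  match k with
  | 0 => row3 1 0 (- u)
  | 1 => row3 0 1 0
  | 2 => row3 0 1 (- u)
  | _ => row3 (- u) 1 0
  end.

Lemma line_ofE D :
  line_of D = [set x | exists t, x = base_point D + t *: direction D]%classic.
Proof.
case: D => [[[|[|[|k]]] u] c]; apply/seteqP; split=> x /=.
all: try by move=> [t /row3P[]]; rewrite !mxE /= => h0 h1 hoo; rewrite ?h0 ?h1 ?hoo;
  split; ring.
- by move=> [h1 <-]; exists (x 0 ix0); apply/row3P; rewrite !mxE /= h1; split; ring.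
- by move=> [h0 hoo]; exists (x 0 ix1); apply/row3P; rewrite !mxE /= h0 hoo; split; ring.
- by move=> [h0 <-]; exists (x 0 ix1); apply/row3P; rewrite !mxE /= h0; split; ring.
- by move=> [hoo <-]; exists (x 0 ix1); apply/row3P; rewrite !mxE /= hoo; split; ring.
Qed.

Lemma direction_neq0 D : direction D != 0.
Proof.
apply/eqP => /row3P[]; case: D => [[[|[|[|k]]] u] c]; rewrite !mxE /= => h0 h1 _.
- by move/eqP: h0; rewrite oner_eq0.
- by move/eqP: h1; rewrite oner_eq0.
- by move/eqP: h1; rewrite oner_eq0.
- by move/eqP: h1; rewrite oner_eq0.
Qed.

Lemma line_of_affine D : is_affine_line (line_of D).
Proof. by exists (base_point D), (direction D); rewrite direction_neq0 line_ofE. Qed.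

Lemma row3E (a b c : R[i]) :
  ((row3 a b c 0 ix0 = a) * (row3 a b c 0 ix1 = b) * (row3 a b c 0 ixoo = c))%type.
Proof. by rewrite !mxE. Qed.

Lemma row3D (a b c a' b' c' t : R[i]) :
  row3 a b c + t *: row3 a' b' c' = row3 (a + t * a') (b + t * b') (c + t * c').
Proof. by apply/row3P; rewrite !row3E !mxE. Qed.

(** Two points of the first line, at [t = 0] and [t = 1], are put into the equations of the second.
    All [k >= 3] encode one shape, hence the bound 4; a zero [u] would blur the shapes, as
    [(1, 0, c)] and [(2, 0, c)] give the same line. *)
Lemma line_of_inj (D D' : line_eqns) :
  (D.1.1 < 4)%N -> (D'.1.1 < 4)%N -> D.1.2 != 0 -> D'.1.2 != 0 ->
  line_of D = line_of D' -> D = D'.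
Proof.
move=> k4 k4' /eqP u0 /eqP u0' eqD.
have mem t : line_of D' (base_point D + t *: direction D).
  by rewrite -eqD line_ofE; exists t.
move: (mem 0) (mem 1) => {eqD mem}.
have subB0 (x y z : R[i]) : x = z -> x - y = z -> y = 0.
  by move=> -> /eqP; rewrite subr_eq addrC -subr_eq subrr eq_sym => /eqP.
have addl0 (x y z : R[i]) : x = z -> y + x = z -> y = 0.
  by move=> -> /eqP; rewrite -subr_eq0 addrK => /eqP.
have /eqP n10 := oner_neq0 R[i].
case: D D' k4 k4' u0 u0' => [[k u] c] [[k' u'] c'] /= k4 k4' u0 u0'.
case: k k4 => [|[|[|[|k]]]] // _.
all: case: k' k4' => [|[|[|[|k']]]] // _.
all: rewrite !row3D !row3E.
all: rewrite ?(mulr0, mulr1, mul0r, mul1r, add0r, addr0) => -[h0 h1] [h2 h3].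
all: try by case: u0'; rewrite -h0.
all: try by case: u0; rewrite (subB0 _ _ _ h0 h2).
all: try by case: u0; rewrite (subB0 _ _ _ h1 h3).
all: try by case: u0'; rewrite (addl0 _ _ _ h1 h3).
all: try by case: n10; rewrite h2.
all: try by rewrite h0 h1.
(* Both lines now have the first shape: [u + 1 / u] fixes [u] only up to inversion, but the second
   equation at [t = 1] gives [u = u']. *)
rewrite h1 (subr0_eq (subB0 c (u - u') c' h1 _)) //.
by rewrite opprB addrA addrAC.
Qed.

(** * From choices of factors to equations *)

(** [None] marks the choices that involve a partial derivative. Being [Some] depends on [c] alone,
    not on the parameters. *)
Definition choice_eqns e0 e1 eoo (c : factor_choice) : option line_eqns :=
  let a0 := e0 + e0^-1 in
  let aoo := eoo + eoo^-1 in
  match nat_of_ord c.1, c.2.1, c.2.2 with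
  | 0, false, false => Some (0%N, e1^-1, aoo)
  | 0, false, true => Some (0%N, e1, e1 * a0)
  | 1, false, false => Some (0%N, (e0 * eoo)^-1, e1 / e0 + eoo^-1)
  | 1, false, true => Some (0%N, e0 * eoo, e0 * e1 + eoo)
  | 2, false, false => Some (0%N, eoo / e0, e1 / e0 + eoo)
  | 2, false, true => Some (0%N, e0 / eoo, e0 * e1 + eoo^-1)
  | 3, false, false | 4, false, false => Some (1%N, e0, e1 / e0)
  | 3, false, true => Some (2%N, e0, e1 * e0 + aoo)
  | 4, true, false => Some (3%N, e1 / e0, e0^-1 + e1 * aoo)
  | 5, false, false | 6, false, false => Some (1%N, e0^-1, e1 * e0)
  | 5, false, true => Some (2%N, e0^-1, e1 / e0 + aoo)
  | 6, true, false => Some (3%N, e1 * e0, e0 + e1 * aoo)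
  | 7, false, false | 8, false, false => Some (1%N, e1 / eoo, eoo)
  | 7, false, true => Some (3%N, eoo, e1 * eoo + a0)
  | 8, true, false => Some (2%N, e1 / eoo, eoo^-1 + e1 * a0)
  | 9, false, false | 10, false, false => Some (1%N, e1 * eoo, eoo^-1)
  | 9, false, true => Some (3%N, eoo^-1, e1 / eoo + a0)
  | 10, true, false => Some (2%N, e1 * eoo, eoo + e1 * a0)
  | _, _, _ => None
  end.

Ltac affine_size :=
  repeat match goal with
  | |- context [mmeasure _ (_ + _)] => apply: msizeD_leq
  | |- context [mmeasure _ (- _)] => apply: msizeN_leq
  | |- context [mmeasure _ (_ *: _)] => apply: msizeZ_leq
  | |- context [mmeasure _ (_ %:MP)] => exact: msizeC_leq
  | |- _ => exact: msizeXU_leq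
  end.
Ltac coef_neq0 :=
  rewrite !(mderiv_simp, meval_simp) /= ?arith_simp ?mulf_eq0 ?invr_eq0 ?oner_eq0 ?negb_or;
  repeat (apply/andP; split).

Lemma admissibleE e0 e1 eoo (c : factor_choice) : e0 != 0 -> e1 != 0 -> eoo != 0 ->
  admissible e0 e1 eoo c = (choice_eqns e0 e1 eoo c != None).
Proof.
move=> e0n0 e1n0 eoon0.
have nonaff a := FV_mderiv_not_affine e0 e1 eoo a.
have nonaff0 a : affine_linear ((FV e0 e1 eoo)^`M(ix0) - X0 + a%:MP) = false.
  by case: (nonaff a).
have nonaff1 : affine_linear (FV e0 e1 eoo)^`M(ix1) = false by case: (nonaff 0).
have nonaffoo a : affine_linear ((FV e0 e1 eoo)^`M(ixoo) - Xoo + a%:MP) = false.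
  by case: (nonaff a).
rewrite /admissible /fst_factor /snd_factor !(tnth_nth ((0, 0), (0, 0))).
case: c => [[[|[|[|[|[|[|[|[|[|[|[|//]]]]]]]]]]] ?] [[] []]] /=.
all: rewrite ?nonaff0 ?nonaff1 ?nonaffoo ?andbF //.
all: apply/andP; split.
(* The variable is picked so that its coefficient is 1 or a product of parameters and their
   inverses. *)
all: lazymatch goal with
| |- context [ix0] => apply: (affine_linearP ix0)
| |- context [ixoo] => apply: (affine_linearP ixoo)
| _ => apply: (affine_linearP ix1)
end; [by affine_size |].
all: by coef_neq0.
Qed.

Lemma eq_iff_scaled (k p q a : R[i]) : k != 0 -> p = k * (q - a) -> p = 0 <-> q = a.
Proof.
move=> k0 ->; split=> [/eqP|->]; last by rewrite subrr mulr0.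
by rewrite mulf_eq0 (negPf k0) subr_eq0 => /eqP.
Qed.

Lemma line_choiceE e0 e1 eoo (c : factor_choice) D : e0 != 0 -> e1 != 0 -> eoo != 0 ->
  choice_eqns e0 e1 eoo c = Some D -> line e0 e1 eoo c = line_of D.
Proof.
move=> e0n0 e1n0 eoon0.
have and_iff (P Q P' Q' : Prop) : (P <-> P') -> (Q <-> Q') -> P /\ Q <-> P' /\ Q'.
  by move=> -> ->.
have and_iffC (P Q P' Q' : Prop) : (P <-> Q') -> (Q <-> P') -> P /\ Q <-> P' /\ Q'.
  by move=> -> ->; split=> -[].
have scaled1 (p q a : R[i]) : p = 1 * (q - a) -> p = 0 <-> q = a.
  exact/eq_iff_scaled/oner_neq0.
rewrite /line /zero_locus /fst_factor /snd_factor !(tnth_nth ((0, 0), (0, 0))).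
case: c => [[[|[|[|[|[|[|[|[|[|[|[|//]]]]]]]]]]] ?] [[] []]] //= [<-].
all: rewrite predeqE => x /=; rewrite !meval_simp.
(* For these choices the normal form lists the two equations in reverse order. *)
9,13,16-18,20-22: by apply: and_iffC; apply: scaled1; field; rewrite ?e0n0 ?e1n0 ?eoon0.
all: apply: and_iff; first by apply: scaled1; field; rewrite ?e0n0 ?e1n0 ?eoon0.
(* In the first three decompositions the second factor must be divided by its coefficient of
   [Xoo]. *)
1: apply: (eq_iff_scaled e1^-1); first exact: invr_neq0.
2: apply: (eq_iff_scaled e1); first exact: e1n0.
3: apply: (eq_iff_scaled e0^-1); first exact: invr_neq0.
4: apply: (eq_iff_scaled e0); first exact: e0n0.
5: apply: (eq_iff_scaled e0^-1); first exact: invr_neq0.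
6: apply: (eq_iff_scaled e0); first exact: e0n0.
7-14: apply: scaled1.
all: by field; rewrite ?e0n0 ?e1n0 ?eoon0.
Qed.

(** * The list of 18 lines *)

(** Four of the 22 admissible choices repeat the line of an earlier decomposition; the other 18 are
    listed by shape. *)
Definition canonical_choices : 18.-tuple factor_choice :=
  let c i lt_i b1 b2 : factor_choice := (@Ordinal 11 i lt_i, (b1, b2)) in
  [tuple c 0%N isT false false; c 0%N isT false true;
         c 1%N isT false false; c 1%N isT false true;
         c 2%N isT false false; c 2%N isT false true;
         c 3%N isT false false; c 5%N isT false false;
         c 7%N isT false false; c 9%N isT false false;
         c 3%N isT false true; c 5%N isT false true;
         c 8%N isT true false; c 10%N isT true false;
         c 4%N isT true false; c 6%N isT true false;
         c 7%N isT false true; c 9%N isT false true].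

Definition lines_eqns e0 e1 eoo : 18.-tuple line_eqns :=
  let a0 := e0 + e0^-1 in
  let aoo := eoo + eoo^-1 in
  [tuple (0%N, e1^-1, aoo); (0%N, e1, e1 * a0);
         (0%N, (e0 * eoo)^-1, e1 / e0 + eoo^-1); (0%N, e0 * eoo, e0 * e1 + eoo);
         (0%N, eoo / e0, e1 / e0 + eoo); (0%N, e0 / eoo, e0 * e1 + eoo^-1);
         (1%N, e0, e1 / e0); (1%N, e0^-1, e1 * e0);
         (1%N, e1 / eoo, eoo); (1%N, e1 * eoo, eoo^-1);
         (2%N, e0, e1 * e0 + aoo); (2%N, e0^-1, e1 / e0 + aoo);
         (2%N, e1 / eoo, eoo^-1 + e1 * a0); (2%N, e1 * eoo, eoo + e1 * a0);
         (3%N, e1 / e0, e0^-1 + e1 * aoo); (3%N, e1 * e0, e0 + e1 * aoo);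
         (3%N, eoo, e1 * eoo + a0); (3%N, eoo^-1, e1 / eoo + a0)].

Lemma canonical_choices_eqns e0 e1 eoo k :
  choice_eqns e0 e1 eoo (tnth canonical_choices k) = Some (tnth (lines_eqns e0 e1 eoo) k).
Proof.
rewrite (tnth_nth (tnth canonical_choices k)) (tnth_nth (0%N, 0, 0)).
by case: k => [[|[|[|[|[|[|[|[|[|[|[|[|[|[|[|[|[|[|//]]]]]]]]]]]]]]]]]] ?].
Qed.

Lemma choice_eqns_canonical (c : factor_choice) : exists k : 'I_18, forall e0 e1 eoo,
  choice_eqns e0 e1 eoo c != None ->
  choice_eqns e0 e1 eoo c = choice_eqns e0 e1 eoo (tnth canonical_choices k).
Proof.
pose o k lt_k : 'I_18 := @Ordinal 18 k lt_k.
case: c => [[[|[|[|[|[|[|[|[|[|[|[|//]]]]]]]]]]] ?] [[] []]].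
(* For choices without equations the premise fails, so any index will do. *)
all: try by exists ord0.
all: solve
  [ by exists (o 1%N isT) | by exists (o 2%N isT) | by exists (o 3%N isT)
  | by exists (o 4%N isT) | by exists (o 5%N isT) | by exists (o 6%N isT)
  | by exists (o 7%N isT) | by exists (o 8%N isT) | by exists (o 9%N isT)
  | by exists (o 10%N isT) | by exists (o 11%N isT) | by exists (o 12%N isT)
  | by exists (o 13%N isT) | by exists (o 14%N isT) | by exists (o 15%N isT)
  | by exists (o 16%N isT) | by exists (o 17%N isT) ].
Qed.

(** * Distinctness and genericity *)

(** The cross relation says that [a / b] is [c / d] or its inverse, so a known [c != d] carries over
    to [a] and [b]. *)
Lemma neq_cross (a b c d : R[i]) :
  a != 0 -> c != d -> a * d = b * c \/ a * c = b * d -> a != b.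
Proof.
move=> a0 neq_cd cross; apply: contraNN neq_cd => /eqP ab; apply/eqP.
by case: cross; rewrite -ab => /(mulfI a0).
Qed.

Ltac cross g :=
  apply: (neq_cross _ _ _ _ _ g);
  [by rewrite ?(mulf_eq0, invr_eq0, negb_or); repeat (apply/andP; split)
  | solve [left; field; repeat (apply/andP; split); assumption
          | right; field; repeat (apply/andP; split); assumption]].

Lemma lines_eqns_uniq e0 e1 eoo : e0 != 0 -> e1 != 0 -> eoo != 0 ->
  generic_parameters e0 e1 eoo -> uniq (lines_eqns e0 e1 eoo).
Proof.
move=> e0n0 e1n0 eoon0 [].
rewrite !inE !negb_or => g0 goo /and4P[g1 g2 g3 g4].
rewrite /= !inE !xpair_eqE /= ?negb_or ?andbT.
repeat (apply/andP; split); try by [].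
(* Within one shape the values of [u] usually differ already, by a ratio that one genericity
   hypothesis keeps away from 1. *)
all: try by apply/nandP; left;
  first [assumption | cross g0 | cross goo | cross g1 | cross g2 | cross g3 | cross g4].
all: apply/negP => /andP[/eqP h1 /eqP h2].
(* Left are the three pairs of lines in one plane [X1 = u + 1 / u] whose [u]
   are inverse to each other. *)
- suff : (e1 - e0 * eoo) * (e1 - eoo / e0) == 0.
    by rewrite mulf_eq0 !subr_eq0 (negPf g1) (negPf g4).
  (* Together [h1] and [h2] make [e1] a root of a quadratic polynomial both of whose roots are
     excluded. *)
  have -> : (e1 - e0 * eoo) * (e1 - eoo / e0)
    = - e1 * (e1^-1 - e1) + eoo * (eoo + eoo^-1 - e1 * (e0 + e0^-1)).
    by field; rewrite ?e0n0 ?e1n0 ?eoon0.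
  by rewrite h1 h2 !subrr !mulr0 addr0.
- suff : (e1 - e0 * eoo) * (e0 ^+ 2 - 1) == 0.
    by rewrite mulf_eq0 !subr_eq0 (negPf g1) (negPf g0).
  (* By [h1], [eoo^-1] is [e0 ^+ 2 * eoo]; after this substitution [h2] factors. The last pair is
     similar. *)
  have -> : (e1 - e0 * eoo) * (e0 ^+ 2 - 1)
    = e0 ^+ 2 * ((e0 * eoo)^-1 - e0 * eoo) - e0 * (e1 / e0 + eoo^-1 - (e0 * e1 + eoo)).
    by field; rewrite ?e0n0 ?eoon0.
  by rewrite h1 h2 !subrr !mulr0 subr0.
- suff : (e1 - eoo / e0) * (e0 ^+ 2 - 1) == 0.
    by rewrite mulf_eq0 !subr_eq0 (negPf g4) (negPf g0).
  have -> : (e1 - eoo / e0) * (e0 ^+ 2 - 1)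
    = eoo / e0 - e0 / eoo - e0 * (e1 / e0 + eoo - (e0 * e1 + eoo^-1)).
    by field; rewrite ?e0n0 ?eoon0.
  by rewrite h1 h2 !subrr mulr0 subr0.
Qed.

(** The four lines parallel to the [X1]-axis, numbered 6 to 9, suffice: their six pairs match the
    six excluded relations, each of which makes one pair coincide. *)
Lemma lines_eqns_generic e0 e1 eoo : e0 != 0 -> eoo != 0 ->
  uniq (lines_eqns e0 e1 eoo) -> generic_parameters e0 e1 eoo.
Proof.
move=> e0n0 eoon0 /tuple_uniqP inj.
have neq (k l : nat) (lt_k : (k < 18)%N) (lt_l : (l < 18)%N) : k != l ->
    nth (0%N, 0, 0) (lines_eqns e0 e1 eoo) k <> nth (0%N, 0, 0) (lines_eqns e0 e1 eoo) l.
  move=> /eqP neq_kl; rewrite -!(tnth_nth _ _ (Ordinal _)) => /inj /(congr1 val).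
  exact: neq_kl.
have n67 := neq 6%N 7%N isT isT isT; have n89 := neq 8%N 9%N isT isT isT.
have n68 := neq 6%N 8%N isT isT isT; have n79 := neq 7%N 9%N isT isT isT.
have n69 := neq 6%N 9%N isT isT isT; have n78 := neq 7%N 8%N isT isT isT.
rewrite /= in n67 n68 n69 n78 n79 n89.
split; last rewrite !inE !negb_or; last (apply/and4P; split); apply/eqP => h.
- have e0V : e0^-1 = e0 by rewrite -[LHS]mulr1 -h; field.
  by apply: n67; rewrite e0V.
- have eooV : eoo^-1 = eoo by rewrite -[LHS]mulr1 -h; field.
  by apply: n89; rewrite eooV.
- by apply: n68; congr (_, _, _); rewrite h; field.
- by apply: n79; congr (_, _, _); rewrite h; field; rewrite ?e0n0 ?eoon0.
- by apply: n69; congr (_, _, _); rewrite h; field; rewrite ?e0n0 ?eoon0.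
- by apply: n78; congr (_, _, _); rewrite h; field; rewrite ?e0n0 ?eoon0.
Qed.

(** * The lines as subsets of the surface *)

Lemma line_sub_SV e0 e1 eoo (c : factor_choice) : e0 != 0 -> e1 != 0 -> eoo != 0 ->
  (line e0 e1 eoo c `<=` SV e0 e1 eoo)%classic.
Proof.
move=> e0n0 e1n0 eoon0 x [/=]; rewrite /SV /zero_locus /= (FV_decomposition _ _ _ c.1) //.
rewrite /two_products_val /fst_factor /snd_factor mevalD !mevalM.
by case: c.2 => [[] []] /= -> ->; rewrite ?(mul0r, mulr0) addr0.
Qed.

Lemma line_canonicalE e0 e1 eoo k : e0 != 0 -> e1 != 0 -> eoo != 0 ->
  line e0 e1 eoo (tnth canonical_choices k) = line_of (tnth (lines_eqns e0 e1 eoo) k).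
Proof.
by move=> e0n0 e1n0 eoon0; apply: line_choiceE => //; exact: canonical_choices_eqns.
Qed.

(** Supplies the side conditions of [line_of_inj]. *)
Lemma lines_eqns_wf e0 e1 eoo k : e0 != 0 -> e1 != 0 -> eoo != 0 ->
  ((tnth (lines_eqns e0 e1 eoo) k).1.1 < 4)%N /\ (tnth (lines_eqns e0 e1 eoo) k).1.2 != 0.
Proof.
move=> e0n0 e1n0 eoon0; rewrite (tnth_nth (0%N, 0, 0)).
by case: k => [[|[|[|[|[|[|[|[|[|[|[|[|[|[|[|[|[|[|//]]]]]]]]]]]]]]]]]] ?] /=; split=> //;
  rewrite ?(mulf_eq0, invr_eq0, negb_or); repeat (apply/andP; split).
Qed.

Lemma line_canonical_inj e0 e1 eoo : e0 != 0 -> e1 != 0 -> eoo != 0 ->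
  injective (fun k : 'I_18 => line e0 e1 eoo (tnth canonical_choices k)) <->
  uniq (lines_eqns e0 e1 eoo).
Proof.
move=> e0n0 e1n0 eoon0; split=> [inj|/tuple_uniqP inj k l].
  apply/tuple_uniqP => k l eq_kl; apply: inj.
  by rewrite !line_canonicalE // eq_kl.
have [k4 k0] := lines_eqns_wf _ _ _ k e0n0 e1n0 eoon0.
have [l4 l0] := lines_eqns_wf _ _ _ l e0n0 e1n0 eoon0.
by rewrite !line_canonicalE // => /(line_of_inj _ _ k4 l4 k0 l0) /inj.
Qed.

End Lines.

Theorem proposition5p6 (R : realType) :
  (forall e0 e1 eoo : R[i], e0 != 0 -> e1 != 0 -> eoo != 0 ->
     (forall i : 'I_11,
        FV e0 e1 eoo = two_products_val (tnth (decompositions e0 e1 eoo) i)) /\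
     (forall c : factor_choice, admissible e0 e1 eoo c ->
        is_affine_line (line e0 e1 eoo c) /\
        (line e0 e1 eoo c `<=` SV e0 e1 eoo)%classic)) /\
  (* the choices c yield 18 lines L_k := line (s k), for a selection s which is
     the same for all parameters *)
  (exists s : 'I_18 -> factor_choice,
     [/\ (forall (k : 'I_18) (e0 e1 eoo : R[i]),
            e0 != 0 -> e1 != 0 -> eoo != 0 -> admissible e0 e1 eoo (s k)),
         (forall c : factor_choice, exists k : 'I_18, forall e0 e1 eoo : R[i],
            e0 != 0 -> e1 != 0 -> eoo != 0 -> admissible e0 e1 eoo c ->
            line e0 e1 eoo c = line e0 e1 eoo (s k)),
         (* the 18 lines are pairwise distinct outside the degenerate locus *)
         (forall e0 e1 eoo : R[i], e0 != 0 -> e1 != 0 -> eoo != 0 ->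
            injective (fun k : 'I_18 => line e0 e1 eoo (s k)) <->
            generic_parameters e0 e1 eoo) &
         (* some of them appear in two decompositions *)
         (exists T : {set 'I_18}, (1 < #|T|)%N /\
            forall k : 'I_18, k \in T ->
            exists c : factor_choice, c.1 != (s k).1 /\
              forall e0 e1 eoo : R[i], e0 != 0 -> e1 != 0 -> eoo != 0 ->
              admissible e0 e1 eoo c /\
              line e0 e1 eoo c = line e0 e1 eoo (s k))]).
Proof.
split=> [e0 e1 eoo e0n0 e1n0 eoon0|].
  split=> [i|c]; first exact: FV_decomposition.
  move=> adm; split; last exact: line_sub_SV.
  move: adm; rewrite admissibleE //.
  case eqns: (choice_eqns e0 e1 eoo c) => [D|] // _.
  by rewrite (line_choiceE _ _ _ _ _ e0n0 e1n0 eoon0 eqns); exact: line_of_affine.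
exists (tnth canonical_choices); split.
- by move=> k e0 e1 eoo e0n0 e1n0 eoon0; rewrite admissibleE // canonical_choices_eqns.
- move=> c; have [k eq_ck] := @choice_eqns_canonical R c.
  exists k => e0 e1 eoo e0n0 e1n0 eoon0; rewrite admissibleE // => /eq_ck.
  by rewrite canonical_choices_eqns line_canonicalE //; exact: line_choiceE.
- move=> e0 e1 eoo e0n0 e1n0 eoon0; rewrite line_canonical_inj //.
  by split; [exact: lines_eqns_generic | exact: lines_eqns_uniq].
- pose o k lt_k : 'I_18 := @Ordinal 18 k lt_k.
  pose c i lt_i : factor_choice := (@Ordinal 11 i lt_i, (false, false)).
  have dup c' k : (forall e0 e1 eoo : R[i], choice_eqns e0 e1 eoo c' =
        choice_eqns e0 e1 eoo (tnth canonical_choices k)) ->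
      forall e0 e1 eoo : R[i], e0 != 0 -> e1 != 0 -> eoo != 0 ->
      admissible e0 e1 eoo c' /\
      line e0 e1 eoo c' = line e0 e1 eoo (tnth canonical_choices k).
    move=> eq_ck e0 e1 eoo e0n0 e1n0 eoon0.
    rewrite admissibleE // eq_ck canonical_choices_eqns line_canonicalE //; split=> //.
    by apply: line_choiceE => //; rewrite eq_ck canonical_choices_eqns.
  (* Each line parallel to the [X1]-axis is cut out by two consecutive decompositions, of which
     [canonical_choices] keeps the earlier. *)
  exists [set o 6%N isT; o 7%N isT; o 8%N isT; o 9%N isT]; split.
    by apply/card_gt1P; exists (o 6%N isT), (o 7%N isT); rewrite !inE.
  move=> k; rewrite !inE -!orbA => /or4P[] /eqP ->.
  + by exists (c 4%N isT); split=> //; exact: dup.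
  + by exists (c 6%N isT); split=> //; exact: dup.
  + by exists (c 8%N isT); split=> //; exact: dup.
  + by exists (c 10%N isT); split=> //; exact: dup.
Qed.
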